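(* Let $\boldsymbol\Xi$ be a relative equilibrium configuration, and let $W_{\boldsymbol\Xi}$ be the vector space generated by the columns of the matrix $M_{\boldsymbol\Xi}$. Then for every vector $\mathbf v_{\boldsymbol\Xi}\in W_{\boldsymbol\Xi}^\perp$ one has $$\langle\boldsymbol\varrho_{\boldsymbol\Xi},\mathbf v_{\boldsymbol\Xi}\rangle=0.$$
   Context: $N$ bodies with masses $m_1,\dots,m_N$ and $m_s=\sum m_i$; bodies $1,\dots,m$ are axially symmetric with unit symmetry axes $\mathbf a_j=(u_j,v_j,w_j)$ (spatial frame) and principal moments of inertia $\Theta_{j1},\Theta_{j1},\Theta_{j3}$, the others are spherically symmetric; $n=N-1$. $\mathbf q_{1i}=(x_i,y_i,z_i)$ ($i=2,\dots,N$) is the relative position vector between body $1$ and body $i$. In a relative equilibrium everything rotates rigidly about $\boldsymbol\omega=\omega\,(0,0,1)^T$; the vectors above are initial values. By $O(3)$-invariance the gravitational potential can be written as a function $\tilde V$ of the invariants $q_{il}=\mathbf q_{1i}\cdot\mathbf q_{1l}$, $\nu_{ij}=\mathbf q_{1i}\cdot\mathbf a_j$, $a_{jk}=\mathbf a_j\cdot\mathbf a_k$ ($j\ne k$). Set $\mathsf a_{ii}=2\,\partial\tilde V/\partial q_{ii}$, $\mathsf a_{il}=\partial\tilde V/\partial q_{il}$ ($i\ne l$), $b_{ij}=\partial\tilde V/\partial\nu_{ij}$, $d_{jk}=\partial\tilde V/\partial a_{jk}$ ($j\ne k$), $d_{jj}=0$. Let $k_j$ be either $\omega(\Theta_{j3}-\Theta_{j1})$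 or $0$, $\mu_j\in\mathbb R$ constants, $\boldsymbol\mu=(\mu_1,\dots,\mu_m)$, $\boldsymbol k=(k_1,\dots,k_m)$, $\mathbf m=(m_2,\dots,m_N)$, $\tau_i=(m_1-m_i)/m_s$. Put $$M=\begin{bmatrix}\{\mathsf a_{il}\}&\{b_{ij}\}\\ \{b_{ij}\}^T&\{d_{jk}\}\end{bmatrix},\quad \mathfrak M=-\frac{\omega^2}{N}\begin{bmatrix}\{\tau_i m_l\}&0\\0&0\end{bmatrix}\quad(i,l=2,\dots,N;\ j,k=1,\dots,m),$$ $$M_1=M+\mathrm{Diag}\left[\left(-\tfrac{\omega^2}{N}\mathbf m,\boldsymbol\mu\right)\right]+\mathfrak M,\qquad M_2=M+\mathrm{Diag}[(\mathbf 0_n,\boldsymbol\mu-\omega\boldsymbol k)].$$ Let $\boldsymbol\Xi=(\xi^T,\eta^T,\zeta^T)^T\in\mathbb R^{3(n+m)}$ with $\xi=(x_2,\dots,x_N,u_1,\dots,u_m)^T$, $\eta=(y_2,\dots,y_N,v_1,\dots,v_m)^T$, $\zeta=(z_2,\dots,z_N,w_1,\dots,w_m)^T$. Let $\boldsymbol\Sigma\in\mathbb R^{n^2+nm+m^2}$ be the vector collecting all the coefficients $\mathsf a_{il}$, $b_{ij}$, $d_{jk}$ ($j\neq k$), $\mu_j$, and let $M_{\boldsymbol\Sigma}=\mathrm{Diag}[M_1,M_1,M_2]$ (block diagonal). $\boldsymbol\Xi$ is a relative equilibrium configuration if $M_{\boldsymbol\Sigma}\boldsymbol\Xi=0$, where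 the coefficients in $\boldsymbol\Sigma$ are evaluated at $\boldsymbol\Xi$ and $\boldsymbol\mu$ is some vector in $\mathbb R^m$. Regarding the entries of $\boldsymbol\Sigma$ as independent variables (with $\omega,\mathbf m,\boldsymbol k$ fixed), $M_{\boldsymbol\Sigma}\boldsymbol\Xi$ is affine in $\boldsymbol\Sigma$, and one defines $$M_{\boldsymbol\Xi}=\frac{\partial(M_{\boldsymbol\Sigma}\boldsymbol\Xi)}{\partial\boldsymbol\Sigma},\qquad \boldsymbol\varrho_{\boldsymbol\Xi}=M_{\boldsymbol\Sigma}\boldsymbol\Xi-M_{\boldsymbol\Xi}\boldsymbol\Sigma,$$ neither of which depends on $\boldsymbol\Sigma$. $W_{\boldsymbol\Xi}^\perp$ is the orthogonal complement in $\mathbb R^{3(n+m)}$. *)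

(* Defs.v *)
From HB Require Import structures.
From mathcomp Require Import all_boot all_order all_algebra.
From mathcomp Require Import all_classical all_reals all_analysis.
Import Order.TTheory GRing.Theory Num.Theory.
Import numFieldNormedType.Exports.

Set Implicit Arguments.
Unset Strict Implicit.
Unset Printing Implicit Defensive.

Local Open Scope ring_scope.

(** Points and vectors of R^3 are row vectors, so a rotation [U] acts by
    [x |-> x *m U], and the coordinates x, y, z have indices [0 1 2 : 'I_3].
    There are [N = n.+1] bodies; body 1 is [ord0], and [i : 'I_n] stands for the
    body [lift ord0 i], one of the bodies 2, ..., N. *)

Section Bodies.
Variable R : realType.

(* The mass distribution of a body in its own frame; tuples are used because
   the library gives them, and not matrices, the product sigma-algebra. *)
Definition mass_distribution := {finite_measure set (3.-tuple R) -> \bar R}.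

Definition vec3 (x : 3.-tuple R) : 'rV[R]_3 := \row_i tnth x i.

Definition enorm (x : 'rV[R]_3) : R := Num.sqrt ((x *m x^T) 0 0).

Definition is_rotation (U : 'M[R]_3) : Prop := U *m U^T = 1%:M /\ \det U = 1.

Definition rotate (U : 'M[R]_3) (x : 3.-tuple R) : 3.-tuple R :=
  [tuple (vec3 x *m U) 0 i | i < 3].

Definition invariant_under (U : 'M[R]_3) (rho : mass_distribution) : Prop :=
  forall A : set (3.-tuple R), measurable A -> rho (rotate U @^-1` A)%classic = rho A.

Definition spherically_symmetric (rho : mass_distribution) : Prop :=
  forall U, is_rotation U -> invariant_under U rho.

(* The symmetry axis is the third axis of the body frame. *)
Definition axially_symmetric (rho : mass_distribution) : Prop :=
  forall U, is_rotation U -> row 2 U = 'e_2 -> invariant_under U rho.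

Definition total_mass (rho : mass_distribution) : R := fine (rho setT).

(* Moment of inertia about the coordinate axis [e] of the body frame. *)
Definition inertia (rho : mass_distribution) (e : 'I_3) : R :=
  fine (\int[rho]_x (\sum_(i | i != e) tnth x i ^+ 2)%:E).

(* Positive mass, finite moments of inertia, body frame with origin at the
   centre of mass. *)
Definition is_body (rho : mass_distribution) : Prop :=
  [/\ 0 < total_mass rho,
      (\int[rho]_x (\sum_i tnth x i ^+ 2)%:E < +oo)%E &
      forall i, (\int[rho]_x (tnth x i)%:E = 0)%E].

(* Here [row i r] is the position of the centre of mass of body [i] and [U i]
   its attitude. The inverse is taken in [\bar R], where [0^-1 = +oo]. *)
Definition gravitational_potential N (G : R) (rho : 'I_N -> mass_distribution)
    (r : 'M[R]_(N, 3)) (U : 'I_N -> 'M[R]_3) : \bar R :=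
  (- (G%:E * \sum_(i < N) \sum_(l < N | (i < l)%N)
      \int[rho i]_x \int[rho l]_y
        ((enorm ((row i r + vec3 x *m U i) - (row l r + vec3 y *m U l))%R)%:E)^-1))%E.

End Bodies.

(* The space of the invariants (q_il, nu_ij, a_jk). The matrices {q_il} and {a_jk}
   are symmetric: q_il and q_li are one and the same variable, and likewise a_jk
   and a_kj. The diagonal entries a_jj = 1 are not variables. *)
Notation invariant_space R n m :=
  ('M[R]_n * 'M[R]_(n, m) * 'M[R]_m)%type (only parsing).

Section Invariants.
Variables (R : realType) (n m : nat).

Definition invariants (q : 'M[R]_(n, 3)) (a : 'M[R]_(m, 3)) : invariant_space R n m :=
  (q *m q^T, q *m a^T, a *m a^T).

Definition relative_positions (r : 'M[R]_(n.+1, 3)) : 'M[R]_(n, 3) :=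
  \matrix_(i < n) (row (lift ord0 i) r - row ord0 r).

Definition symmetry_axes (hm : (m <= n.+1)%N) (U : 'I_n.+1 -> 'M[R]_3) :
    'M[R]_(m, 3) :=
  \matrix_(j < m) row 2 (U (widen_ord hm j)).

(* [Vt] expresses the gravitational potential through the invariants. *)
Definition represents_potential (hm : (m <= n.+1)%N) (G : R)
    (rho : 'I_n.+1 -> mass_distribution R)
    (Vt : invariant_space R n m -> R) : Prop :=
  forall (r : 'M[R]_(n.+1, 3)) (U : 'I_n.+1 -> 'M[R]_3),
    (forall i, is_rotation (U i)) ->
    gravitational_potential G rho r U \is a fin_num ->
    gravitational_potential G rho r U =
      (Vt (invariants (relative_positions r) (symmetry_axes hm U)))%:E.

(* Directions of the partial derivatives: off the diagonal, the variables q_il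
   and a_jk occupy two entries of the corresponding symmetric matrix. *)
Definition sym_delta p (i l : 'I_p) : 'M[R]_p :=
  if i == l then delta_mx i i else delta_mx i l + delta_mx l i.

Definition dir_q (i l : 'I_n) : invariant_space R n m :=
  (sym_delta i l, 0, 0).
Definition dir_nu (i : 'I_n) (j : 'I_m) : invariant_space R n m :=
  (0, delta_mx i j, 0).
Definition dir_a (j k : 'I_m) : invariant_space R n m :=
  (0, 0, sym_delta j k).

Variable Vt : invariant_space R n m -> R.

Definition has_partials (s : invariant_space R n m) : Prop :=
  [/\ forall i l, derivable Vt s (dir_q i l),
      forall i j, derivable Vt s (dir_nu i j) &
      forall j k, j != k -> derivable Vt s (dir_a j k)].

Definition coef_a (s : invariant_space R n m) : 'M[R]_n :=
  \matrix_(i, l) if i == l then 2 * 'D_(dir_q i i) Vt s else 'D_(dir_q i l) Vt s.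
Definition coef_b (s : invariant_space R n m) : 'M[R]_(n, m) :=
  \matrix_(i, j) 'D_(dir_nu i j) Vt s.
Definition coef_d (s : invariant_space R n m) : 'M[R]_m :=
  \matrix_(j, k) if j == k then 0 else 'D_(dir_a j k) Vt s.

End Invariants.

Section Equilibria.
Variables (R : realType) (n m : nat).

(* Sigma has n^2 + nm + m^2 entries: all the a_il (a_il and a_li are distinct
   entries), the b_ij, and an m x m block with d_jk off the diagonal and mu_j on
   the diagonal. *)
Definition dim_Sigma : nat := (n * n + n * m + m * m)%N.
Definition dim_Xi : nat := ((n + m) + ((n + m) + (n + m)))%N.

Definition Sigma_of (A : 'M[R]_n) (B : 'M[R]_(n, m)) (D : 'M[R]_m) (mu : 'rV[R]_m) :
    'cV[R]_dim_Sigma :=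
  col_mx (col_mx (mxvec A)^T (mxvec B)^T)
         (mxvec (\matrix_(j, k) if j == k then mu 0 j else D j k))^T.

Definition Sigma_a (S : 'cV[R]_dim_Sigma) : 'M[R]_n := vec_mx (usubmx (usubmx S))^T.
Definition Sigma_b (S : 'cV[R]_dim_Sigma) : 'M[R]_(n, m) := vec_mx (dsubmx (usubmx S))^T.
Definition Sigma_dmu (S : 'cV[R]_dim_Sigma) : 'M[R]_m := vec_mx (dsubmx S)^T.
Definition Sigma_d (S : 'cV[R]_dim_Sigma) : 'M[R]_m :=
  \matrix_(j, k) if j == k then 0 else Sigma_dmu S j k.
Definition Sigma_mu (S : 'cV[R]_dim_Sigma) : 'rV[R]_m := \row_j Sigma_dmu S j j.

Variables (mass : 'I_n.+1 -> R) (omega : R) (k : 'rV[R]_m).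

Definition mass_tail : 'rV[R]_n := \row_i mass (lift ord0 i).
Definition tau (i : 'I_n) : R :=
  (mass ord0 - mass (lift ord0 i)) / \sum_i mass i.

Definition mat_M (S : 'cV[R]_dim_Sigma) : 'M[R]_(n + m) :=
  block_mx (Sigma_a S) (Sigma_b S) (Sigma_b S)^T (Sigma_d S).

Definition mat_frakM : 'M[R]_(n + m) :=
  - (omega ^+ 2 / n.+1%:R) *: block_mx (\matrix_(i, l) (tau i * mass_tail 0 l)) 0 0 0.

Definition mat_M1 (S : 'cV[R]_dim_Sigma) : 'M[R]_(n + m) :=
  mat_M S + diag_mx (row_mx (- (omega ^+ 2 / n.+1%:R) *: mass_tail) (Sigma_mu S))
  + mat_frakM.

Definition mat_M2 (S : 'cV[R]_dim_Sigma) : 'M[R]_(n + m) :=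
  mat_M S + diag_mx (row_mx 0 (Sigma_mu S - omega *: k)).

Definition mat_MSigma (S : 'cV[R]_dim_Sigma) : 'M[R]_dim_Xi :=
  block_mx (mat_M1 S) 0 0 (block_mx (mat_M1 S) 0 0 (mat_M2 S)).

(* The rows of [q] and [a] are the vectors q_1i and a_j. *)
Definition Xi_of (q : 'M[R]_(n, 3)) (a : 'M[R]_(m, 3)) : 'cV[R]_dim_Xi :=
  let X := col_mx q a in col_mx (col 0 X) (col_mx (col 1 X) (col 2 X)).

Definition is_relative_equilibrium (Vt : invariant_space R n m -> R)
    (q : 'M[R]_(n, 3)) (a : 'M[R]_(m, 3)) : Prop :=
  let s := invariants q a in
  [/\ forall j, enorm (row j a) = 1,
      has_partials Vt s &
      exists mu : 'rV[R]_m,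
        mat_MSigma (Sigma_of (coef_a Vt s) (coef_b Vt s) (coef_d Vt s) mu)
          *m Xi_of q a = 0].

(* The Jacobian matrix of S |-> M_S Xi at [S]. The library's ['J] is for maps
   between row vectors and is the transpose of the usual one. As M_S Xi is affine
   in S, neither [mat_MXi Xi S] nor [varrho Xi S] depends on [S]. *)
Definition mat_MXi (Xi : 'cV[R]_dim_Xi) (S : 'cV[R]_dim_Sigma) :
    'M[R]_(dim_Xi, dim_Sigma) :=
  ('J (fun s : 'rV[R]_dim_Sigma => (mat_MSigma s^T *m Xi)^T) S^T)^T.

Definition varrho (Xi : 'cV[R]_dim_Xi) (S : 'cV[R]_dim_Sigma) : 'cV[R]_dim_Xi :=
  mat_MSigma S *m Xi - mat_MXi Xi S *m S.

Definition W_Xi (Xi : 'cV[R]_dim_Xi) (S : 'cV[R]_dim_Sigma) : {vspace 'cV[R]_dim_Xi} :=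
  <<[seq col c (mat_MXi Xi S) | c <- enum 'I_dim_Sigma]>>%VS.

End Equilibria.

Definition dotc (R : realType) p (u v : 'cV[R]_p) : R := \sum_i u i 0 * v i 0.

Definition in_orthogonal (R : realType) p (W : {vspace 'cV[R]_p}) (v : 'cV[R]_p) : Prop :=
  forall u, u \in W -> dotc u v = 0.

(* Main.v *)
Require Import Defs.
From HB Require Import structures.
From mathcomp Require Import all_boot all_order all_algebra.
From mathcomp Require Import all_classical all_reals all_analysis.
Import Order.TTheory GRing.Theory Num.Theory.
Import numFieldNormedType.Exports.
Local Open Scope ring_scope.

(** The map taking [S] to [M_S Xi] is affine in [S]: the coefficients enter the
    blocks [M_1, M_1, M_2] only through one and the same linear expression
    [coef_part S], and the terms in omega, the masses and k form a constant
    block-diagonal matrix. Hence its Jacobian matrix [M_Xi], applied to [S],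
    gives back the linear part of [M_S Xi], and
    [varrho = M_S Xi - M_Xi S] is the constant part, whatever [S] and whatever
    the point at which the Jacobian is taken.

    A relative equilibrium supplies one [S0], made of the partial derivatives
    of the potential and of the multipliers [mu], with [M_{S0} Xi = 0]. Then
    [varrho = - M_Xi S0] is a linear combination of the columns of [M_Xi], so it
    lies in [W_Xi] and is orthogonal to the orthogonal complement of [W_Xi]. *)

(** * The Jacobian matrix of an affine map *)

(** In finite dimension linearity is enough for continuity: the map is
    [u |-> \sum_i u 0 i *: L 'e_i], a finite sum of coordinate functions times
    fixed vectors. *)
Lemma linear_rV_continuous (R : realType) (p r : nat)
    (L : {linear 'rV[R]_p -> 'rV[R]_r}) : continuous L.
Proof.
have -> : (L : 'rV[R]_p -> 'rV[R]_r) =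
    \sum_(i < p) (fun u : 'rV[R]_p => u 0 i *: L 'e_i).
  apply/funext => u; rewrite {1}(row_sum_delta u) linear_sum fct_sumE.
  by apply: eq_bigr => i _; rewrite linearZ.
move=> x; apply: differentiable_continuous; apply: differentiable_sum => i.
exact/differentiableZl/differentiable_coord.
Qed.

Lemma mulmx_jacobian_affine (R : realType) (p r : nat)
    (L : {linear 'rV[R]_p -> 'rV[R]_r}) (c : 'rV[R]_r) (x u : 'rV[R]_p) :
  u *m 'J (fun s => L s + c) x = L u.
Proof.
have Lc := linear_rV_continuous R p r L.
have dL : is_diff x L L.
  by apply: DiffDef; [exact: linear_differentiable|exact: diff_lin].
have dLc := is_diffD dL (is_diff_cst c x).
rewrite /jacobian mul_rV_lin1 -[RHS]addr0.
have diff_Lc := @diff_val _ _ _ _ _ _ _ dLc.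
exact (congr1 (fun h : 'rV[R]_p -> 'rV[R]_r => h u) diff_Lc).
Qed.

(** * The affine dependence of [M_S Xi] on [S] *)

Section AffineDependence.
Variables (R : realType) (n m : nat).
Variables (mass : 'I_n.+1 -> R) (omega : R) (k : 'rV[R]_m).
Implicit Types (S T : 'cV[R]_(dim_Sigma n m)) (Xi : 'cV[R]_(dim_Xi n m)).

(** What [M_1] and [M_2] have in common once every term in omega is removed. *)
Definition coef_part S : 'M[R]_(n + m) :=
  mat_M S + diag_mx (row_mx 0 (Sigma_mu S)).

Definition const_part1 : 'M[R]_(n + m) :=
  diag_mx (row_mx (- (omega ^+ 2 / n.+1%:R) *: mass_tail mass) 0)
  + mat_frakM m mass omega.

Definition const_part2 : 'M[R]_(n + m) := diag_mx (row_mx 0 (- omega *: k)).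

Definition coef_part_MSigma S : 'M[R]_(dim_Xi n m) :=
  block_mx (coef_part S) 0 0 (block_mx (coef_part S) 0 0 (coef_part S)).

Definition const_part_MSigma : 'M[R]_(dim_Xi n m) :=
  block_mx const_part1 0 0 (block_mx const_part1 0 0 const_part2).

Lemma mat_MSigmaE S :
  mat_MSigma mass omega k S = coef_part_MSigma S + const_part_MSigma.
Proof.
have split1 : mat_M1 mass omega S = coef_part S + const_part1.
  rewrite /mat_M1 /coef_part /const_part1 addrA; congr (_ + _).
  by rewrite -addrA; congr (_ + _); rewrite -raddfD/= add_row_mx add0r addr0.
have split2 : mat_M2 omega k S = coef_part S + const_part2.
  rewrite /mat_M2 /coef_part /const_part2 -addrA; congr (_ + _).
  by rewrite -raddfD/= add_row_mx addr0 scaleNr.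
by rewrite /mat_MSigma split1 split2 /coef_part_MSigma /const_part_MSigma
  !add_block_mx !addr0.
Qed.

Lemma coef_part_linear (c : R) S T :
  coef_part (c *: S + T) = c *: coef_part S + coef_part T.
Proof.
have aL : Sigma_a (c *: S + T) = c *: Sigma_a S + Sigma_a T.
  by rewrite /Sigma_a !linearP.
have bL : Sigma_b (c *: S + T) = c *: Sigma_b S + Sigma_b T.
  by rewrite /Sigma_b !linearP.
have dmuL : Sigma_dmu (c *: S + T) = c *: Sigma_dmu S + Sigma_dmu T.
  by rewrite /Sigma_dmu !linearP.
have dL : Sigma_d (c *: S + T) = c *: Sigma_d S + Sigma_d T.
  apply/matrixP => i j; rewrite /Sigma_d dmuL !mxE.
  by case: eqP => _ //; rewrite mulr0 addr0.
have muL : Sigma_mu (c *: S + T) = c *: Sigma_mu S + Sigma_mu T.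
  by apply/rowP => j; rewrite /Sigma_mu dmuL !mxE.
have MuL : row_mx 0 (Sigma_mu (c *: S + T)) =
    c *: row_mx 0 (Sigma_mu S) + row_mx (0 : 'rV[R]_n) (Sigma_mu T).
  by rewrite muL scale_row_mx add_row_mx scaler0 addr0.
rewrite /coef_part MuL linearP /= scalerDr addrACA; congr (_ + _).
by rewrite /mat_M aL bL dL linearP /= scale_block_mx add_block_mx.
Qed.

(** The linear part of [M_S Xi], written on row vectors because this is where
    the Jacobian is defined. *)
Definition linear_part Xi (s : 'rV[R]_(dim_Sigma n m)) : 'rV[R]_(dim_Xi n m) :=
  (coef_part_MSigma s^T *m Xi)^T.

Lemma linear_part_is_linear Xi : linear (linear_part Xi).
Proof.
move=> c s t; rewrite /linear_part linearP /=.
have -> : coef_part_MSigma (c *: s^T + t^T) =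
    c *: coef_part_MSigma s^T + coef_part_MSigma t^T.
  rewrite /coef_part_MSigma coef_part_linear !scale_block_mx !add_block_mx.
  by rewrite !scaler0 !addr0.
by rewrite mulmxDl -scalemxAl linearP.
Qed.

HB.instance Definition _ Xi := GRing.isLinear.Build R 'rV[R]_(dim_Sigma n m)
  'rV[R]_(dim_Xi n m) *:%R (linear_part Xi) (linear_part_is_linear Xi).

(** [S] is where the Jacobian is taken and [T] what it is applied to; the
    independence of [S] is what lets the equilibrium value of [T] be combined
    with an arbitrary [S]. *)
Lemma mat_MXi_mul Xi S T :
  mat_MXi mass omega k Xi S *m T = coef_part_MSigma T *m Xi.
Proof.
have linear_part_J : T^T *m 'J (fun s : 'rV[R]_(dim_Sigma n m) =>
    (mat_MSigma mass omega k s^T *m Xi)^T) S^T = linear_part Xi T^T.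
  rewrite (_ : (fun s => _) =
      (fun s => linear_part Xi s + (const_part_MSigma *m Xi)^T)); last first.
    by apply/funext => s; rewrite mat_MSigmaE mulmxDl linearD.
  exact: mulmx_jacobian_affine.
apply: trmx_inj; rewrite /mat_MXi trmx_mul.
(* The normed-space instances carried by the Jacobian hide the double
   transpose from keyed rewriting, hence the explicit congruence. *)
rewrite (etrans (congr1 (mulmx T^T) (trmxK _)) linear_part_J).
by rewrite /linear_part trmxK.
Qed.

Lemma varrhoE Xi S : varrho mass omega k Xi S = const_part_MSigma *m Xi.
Proof. by rewrite /varrho mat_MXi_mul mat_MSigmaE mulmxDl addrC addKr. Qed.

Lemma mat_MXi_mul_in_W Xi S T :
  mat_MXi mass omega k Xi S *m T \in W_Xi mass omega k Xi S.
Proof.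
have -> : mat_MXi mass omega k Xi S *m T =
    \sum_c T c 0 *: col c (mat_MXi mass omega k Xi S).
  apply/colP => i; rewrite mxE summxE.
  by apply: eq_bigr => c _; rewrite !mxE mulrC.
apply: memv_suml => c _; apply/memvZ/memv_span.
by apply: map_f; rewrite mem_enum.
Qed.

(** Splitting [M_{S0} Xi = 0] into its linear and constant parts turns the
    constant part, which is [varrho], into [- M_Xi S0]. *)
Lemma varrho_in_W Xi S S0 :
  mat_MSigma mass omega k S0 *m Xi = 0 ->
  varrho mass omega k Xi S \in W_Xi mass omega k Xi S.
Proof.
rewrite mat_MSigmaE mulmxDl addrC => /eqP; rewrite addr_eq0 -(mat_MXi_mul Xi S).
by rewrite varrhoE => /eqP ->; rewrite memvN mat_MXi_mul_in_W.
Qed.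

End AffineDependence.

(** * Orthogonality at a relative equilibrium *)

Theorem proposition5p1 (R : realType) (n m : nat) (hm : (m <= n.+1)%N)
    (G : R) (rho : 'I_n.+1 -> mass_distribution R)
    (Vt : invariant_space R n m -> R)
    (omega : R) (k : 'rV[R]_m) (q : 'M[R]_(n, 3)) (a : 'M[R]_(m, 3)) :
  let mass := fun i => total_mass (rho i) in
  let Xi := Xi_of q a in
  0 < G ->
  (forall i, is_body (rho i)) ->
  (forall i : 'I_n.+1, (i < m)%N -> axially_symmetric (rho i)) ->
  (forall i : 'I_n.+1, (m <= i)%N -> spherically_symmetric (rho i)) ->
  represents_potential hm G rho Vt ->
  (forall j : 'I_m, let Th := inertia (rho (widen_ord hm j)) in
     k 0 j = omega * (Th 2 - Th 0) \/ k 0 j = 0) ->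
  is_relative_equilibrium mass omega k Vt q a ->
  forall (S : 'cV[R]_(dim_Sigma n m)) (v : 'cV[R]_(dim_Xi n m)),
    in_orthogonal (W_Xi mass omega k Xi S) v ->
    dotc (varrho mass omega k Xi S) v = 0.
Proof.
move=> mass Xi _ _ _ _ _ _ [_ _ [mu equilibrium]] S v orth.
by apply: orth; apply: varrho_in_W equilibrium.
Qed.
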